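(* For any ideal tetrahedron in $\mathbb{H}^3$ with spin-decorated horospheres $(\mathcal{h}_i,W_i)$ ($i=0,1,2,3$) about its vertices, let $\lambda_{ij}$ be the complex lambda length from $(\mathcal{h}_i,W_i)$ to $(\mathcal{h}_j,W_j)$. Then $$\lambda_{02}\lambda_{13}=\lambda_{01}\lambda_{23}+\lambda_{12}\lambda_{03}.$$
   Context: **Spin-decorated horospheres.** A frame is a right-handed orthonormal frame $(f_1,f_2,f_3)$ at a point of hyperbolic 3-space $\mathbb{H}^3$. $\mathrm{Fr}\to\mathbb{H}^3$ is the principal $SO(3)$ bundle of frames and $\mathrm{Spin}$ its double (universal) cover, whose points are spin frames. On a horosphere, $N^{out}$ is the unit normal field pointing towards its centre (its point at infinity) and $N^{in}=-N^{out}$. A tangent vector field on a horosphere is parallel if it is invariant under all parabolic isometries preserving the horosphere. For a unit parallel tangent vector field $\mathcal V$ on a horosphere, $f^{out}(\mathcal V)=(N^{out},\mathcal V,N^{out}\times\mathcal V)$ and $f^{in}(\mathcal V)=(N^{in},\mathcal V,N^{in}\times\mathcal V)$. An outward (inward) spin decoration is a continuous lift to $\mathrm{Spin}$ of some $f^{out}(\mathcal V)$ ($f^{in}(\mathcal V)$). The inward spin decoration associated to an outward one $W^{out}$ is obtained by rotating $W^{out}$ by angle $\pi$ about $\mathcal V$ at each point; the outward one associated to $W^{in}$ is obtained by rotating $W^{in}$ by $-\pi$ about $\mathcal V$ (right-handed rotations). A spin decoration on a horosphere $\mathcal{h}$ is a pair $W=(W^{in},W^{out})$, each associated to the other, and $(\mathcal{h},W)$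 is a spin-decorated horosphere. **Complex lambda length.** A spin frame at a point of an oriented geodesic $\gamma$ is adapted to $\gamma$ if the first vector of its underlying frame is positively tangent to $\gamma$. If two spin frames at points of $\gamma$ are adapted to $\gamma$, the complex distance from the first to the second is $d=\rho+i\theta$, where translation along $\gamma$ by signed distance $\rho$ followed by rotation about $\gamma$ by angle $\theta$ takes the first to the second; it is well defined modulo $4\pi i$. For spin-decorated horospheres $(\mathcal{h}_1,W_1),(\mathcal{h}_2,W_2)$ with distinct centres $p_1,p_2$, let $\gamma_{12}$ be the oriented geodesic from $p_1$ to $p_2$ and $q_i=\gamma_{12}\cap\mathcal{h}_i$; the complex lambda length from $(\mathcal{h}_1,W_1)$ to $(\mathcal{h}_2,W_2)$ is $\lambda_{12}=\exp(d/2)$, where $d$ is the complex distance from $W_1^{in}(q_1)$ to $W_2^{out}(q_2)$ along $\gamma_{12}$. If the centres coincide, $\lambda_{12}=0$. ''About its vertices'' means that $\mathcal{h}_i$ is centred at the $i$-th ideal vertex. *)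

(* Defs.v *)
(* Hyperbolic 3-space is the upper sheet of the hyperboloid in Minkowski space
   R^{1,3}, whose vectors are the row vectors 'rV[R]_4 (coordinate 0 is time).
   The Minkowski form has signature (-,+,+,+), so its restriction to a tangent
   space of the hyperboloid is the hyperbolic metric, and H^3 carries the
   orientation for which a basis (u1, u2, u3) of the tangent space at x is
   right-handed when det (x, u1, u2, u3) > 0.  The orientation-preserving
   isometries act as the matrices of SO^+(1,3), on the right of row vectors. *)
From HB Require Import structures.
From mathcomp Require Import all_boot all_order all_algebra.
From mathcomp Require Import all_classical all_reals all_analysis.
From mathcomp.real_closed Require Import complex.

Set Implicit Arguments.
Unset Strict Implicit.
Unset Printing Implicit Defensive.

Import Order.TTheory GRing.Theory Num.Theory.
Import numFieldNormedType.Exports.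

Local Open Scope classical_set_scope.
Local Open Scope ring_scope.

Section Minkowski.
Variable R : realType.
Local Notation vec := 'rV[R]_4.

Definition lor (x y : vec) : R :=
  - (x 0 0 * y 0 0) + x 0 1 * y 0 1 + x 0 2 * y 0 2 + x 0 3 * y 0 3.

Definition H3 : set vec := [set x | lor x x = - 1 /\ 0 < x 0 0].

Definition unit_tangent (x u : vec) : Prop := lor x u = 0 /\ lor u u = 1.

Definition mat_of_rows (x u v w : vec) : 'M[R]_4 :=
  \matrix_(i, j) (nth 0 [:: x; u; v; w] i) 0 j.

(* The cross product u x v in the oriented tangent space at x: the vector c
   with lor c w = det (x, u, v, w) for every w. *)
Definition cross (x u v : vec) : vec :=
  \row_j ((if j == 0 then -1 else 1) * \det (mat_of_rows x u v (delta_mx 0 j))).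

(* Points at infinity are the rays of the future light cone, each represented
   by any of its vectors. *)
Definition light_cone : set vec := [set p | lor p p = 0 /\ 0 < p 0 0].

Definition same_ideal (p q : vec) : Prop :=
  exists c : R, 0 < c /\ q = c *: p.

(* x lies on the oriented geodesic from p to q, and u is its positive unit
   tangent there.  The unit-speed geodesic through x with velocity u is
   s |-> cosh s x + sinh s u = (e^s / 2) (x + u) + (e^-s / 2) (x - u), so its
   endpoints are the rays of x - u (s -> -oo) and x + u (s -> +oo). *)
Definition on_geodesic (p q x u : vec) : Prop :=
  [/\ H3 x, unit_tangent x u, same_ideal (x - u) p & same_ideal (x + u) q].

(* n |-> horosphere n is a bijection from the future light cone onto the
   horospheres; the centre of horosphere n is the ray of n. *)
Definition horosphere (n : vec) : set vec :=
  [set x | H3 x /\ lor x n = - 1].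

(* For x on horosphere n, the vector n - x is a unit tangent vector at x that is
   normal to the horosphere (whose tangent space is {x, n}^perp), and it points
   to the centre since x + (n - x) = n. *)
Definition Nout (n x : vec) : vec := n - x.
Definition Nin (n x : vec) : vec := - Nout n x.

Definition isometry_or (g : 'M[R]_4) : Prop :=
  [/\ forall x y : vec, lor (x *m g) (y *m g) = lor x y,
      forall x, H3 x -> H3 (x *m g)
    & \det g = 1].

Definition parabolic (g : 'M[R]_4) : Prop :=
  [/\ isometry_or g,
      forall x, H3 x -> x *m g <> x
    & exists p, [/\ light_cone p, same_ideal p (p *m g)
      & forall q, light_cone q -> same_ideal q (q *m g) -> same_ideal p q]].

Definition tangent_field (n : vec) (V : vec -> vec) : Prop :=
  forall x, horosphere n x -> lor x (V x) = 0 /\ lor n (V x) = 0.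

(* V (x *m g) = V x *m g: a linear isometry is its own differential. *)
Definition parallel_field (n : vec) (V : vec -> vec) : Prop :=
  tangent_field n V /\
  forall g, parabolic g -> [set x *m g | x in horosphere n] = horosphere n ->
  forall x, horosphere n x -> V (x *m g) = V x *m g.

Definition unit_parallel_field (n : vec) (V : vec -> vec) : Prop :=
  parallel_field n V /\ forall x, horosphere n x -> lor (V x) (V x) = 1.

Record frame := Frame { fpt : vec; fr1 : vec; fr2 : vec; fr3 : vec }.

Definition is_frame (F : frame) : Prop :=
  [/\ H3 (fpt F),
      [/\ unit_tangent (fpt F) (fr1 F), unit_tangent (fpt F) (fr2 F)
        & unit_tangent (fpt F) (fr3 F)],
      [/\ lor (fr1 F) (fr2 F) = 0, lor (fr1 F) (fr3 F) = 0
        & lor (fr2 F) (fr3 F) = 0]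
    & 0 < \det (mat_of_rows (fpt F) (fr1 F) (fr2 F) (fr3 F))].

Definition fout (n : vec) (V : vec -> vec) (x : vec) : frame :=
  Frame x (Nout n x) (V x) (cross x (Nout n x) (V x)).
Definition fin (n : vec) (V : vec -> vec) (x : vec) : frame :=
  Frame x (Nin n x) (V x) (cross x (Nin n x) (V x)).

Definition coshR (s : R) : R := (expR s + expR (- s)) / 2.
Definition sinhR (s : R) : R := (expR s - expR (- s)) / 2.

(* Right-handed rotation of the tangent space at x by angle theta about the unit
   tangent vector v (Rodrigues' formula). *)
Definition rot (x v : vec) (theta : R) (u : vec) : vec :=
  cos theta *: u + ((1 - cos theta) * lor u v) *: v + sin theta *: cross x v u.

Definition rotate_frame (v : vec) (theta : R) (F : frame) : frame :=
  Frame (fpt F) (rot (fpt F) v theta (fr1 F)) (rot (fpt F) v theta (fr2 F))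
        (rot (fpt F) v theta (fr3 F)).

(* Translation by signed distance s along the geodesic through x with velocity
   v: x |-> cosh s x + sinh s v, v |-> sinh s x + cosh s v, and the identity on
   {x, v}^perp. *)
Definition transl (x v : vec) (s : R) (y : vec) : vec :=
  y - lor y x *: (coshR s *: x + sinhR s *: v - x)
    + lor y v *: (sinhR s *: x + coshR s *: v - v).

Definition translate_frame (v : vec) (s : R) (F : frame) : frame :=
  Frame (transl (fpt F) v s (fpt F)) (transl (fpt F) v s (fr1 F))
        (transl (fpt F) v s (fr2 F)) (transl (fpt F) v s (fr3 F)).

End Minkowski.

Section Spin.
Variable R : realType.
Local Notation C := (R[i]).
Local Notation vec := 'rV[R]_4.

Definition mx22 (a b c d : C) : 'M[C]_2 :=
  \matrix_(i, j) (if i == 0 then if j == 0 then a else b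
                  else if j == 0 then c else d).

(* Minkowski space as Hermitian 2 x 2 matrices, with - lor v v = det (herm v). *)
Definition herm (v : vec) : 'M[C]_2 :=
  mx22 (Complex (v 0 0 + v 0 3) 0)     (Complex (v 0 1) (v 0 2))
       (Complex (v 0 1) (- v 0 2))     (Complex (v 0 0 - v 0 3) 0).

Definition unherm (S : 'M[C]_2) : vec :=
  \row_(k < 4) nth 0 [:: (complex.Re (S 0 0) + complex.Re (S 1 1)) / 2;
                         complex.Re (S 0 1); complex.Im (S 0 1);
                         (complex.Re (S 0 0) - complex.Re (S 1 1)) / 2] k.

Definition spin_act (A : 'M[C]_2) (v : vec) : vec :=
  unherm (A *m herm v *m (map_mx conjc A)^T).

(* The spin frame bundle is realised by SL(2,C): it is simply connected, and acts
   on H^3 and on Fr through the double cover SL(2,C) -> SO^+(1,3), the latter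
   group acting simply transitively on frames.  Applying A to the right-handed
   base frame (e3, e1, e2) at e0 therefore gives the universal double cover
   SL(2,C) -> Fr; the other choices of base spin frame give isomorphic covers. *)
Definition spin_frame : set 'M[C]_2 := [set A | \det A = 1].

Definition spin_proj (A : 'M[C]_2) : frame R :=
  Frame (spin_act A (delta_mx 0 0)) (spin_act A (delta_mx 0 3))
        (spin_act A (delta_mx 0 1)) (spin_act A (delta_mx 0 2)).

(* Continuity on D for the topology of SL(2,C) as a subset of C^4 = R^8, stated
   through real components because R[i] carries no canonical topology. *)
Definition spin_continuous (T : topologicalType) (D : set T)
    (W : T -> 'M[C]_2) : Prop :=
  forall i j, {within D, continuous (fun x => complex.Re (W x i j))} /\
              {within D, continuous (fun x => complex.Im (W x i j))}.

(* The path of frames Phi on [0, 1] has a continuous lift to Spin going from the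
   spin frame A to the spin frame B.  Motions of spin frames (rotations,
   translations) are defined by lifting the motion of the underlying frame, so a
   rotation by 2 pi exchanges the two lifts of a frame. *)
Definition spin_path (Phi : R -> frame R) (A B : 'M[C]_2) : Prop :=
  exists w : R -> 'M[C]_2,
    [/\ spin_continuous (`[0, 1] : set R) w,
        forall t, 0 <= t <= 1 -> spin_frame (w t) /\ spin_proj (w t) = Phi t,
        w 0 = A & w 1 = B].

Definition spin_rotate (v : vec) (theta : R) (A B : 'M[C]_2) : Prop :=
  spin_path (fun t => rotate_frame v (t * theta) (spin_proj A)) A B.

Definition spin_translate (v : vec) (s : R) (A B : 'M[C]_2) : Prop :=
  spin_path (fun t => translate_frame v (t * s) (spin_proj A)) A B.

Definition spin_lift (n : vec) (f : vec -> frame R) (W : vec -> 'M[C]_2) :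
    Prop :=
  spin_continuous (horosphere n) W /\
  forall x, horosphere n x ->
    [/\ is_frame (f x), spin_frame (W x) & spin_proj (W x) = f x].

Definition outward_spin_decoration (n : vec) (W : vec -> 'M[C]_2) : Prop :=
  exists V, unit_parallel_field n V /\ spin_lift n (fout n V) W.

Definition inward_spin_decoration (n : vec) (W : vec -> 'M[C]_2) : Prop :=
  exists V, unit_parallel_field n V /\ spin_lift n (fin n V) W.

(* V x is the second vector of the frame underlying a decoration at x. *)
Definition spin_decoration (n : vec) (Win Wout : vec -> 'M[C]_2) : Prop :=
  [/\ inward_spin_decoration n Win, outward_spin_decoration n Wout,
      forall x, horosphere n x ->
        spin_rotate (fr2 (spin_proj (Wout x))) pi (Wout x) (Win x)
    & forall x, horosphere n x ->
        spin_rotate (fr2 (spin_proj (Win x))) (- pi) (Win x) (Wout x)].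

Record spin_horosphere := SpinHorosphere {
  hvec : vec;
  Win : vec -> 'M[C]_2;
  Wout : vec -> 'M[C]_2;
  hvecP : light_cone hvec;
  decorationP : spin_decoration hvec Win Wout
}.

Definition centred_at (S : spin_horosphere) (p : vec) : Prop :=
  same_ideal p (hvec S).

Definition adapted (p q : vec) (A : 'M[C]_2) : Prop :=
  spin_frame A /\ on_geodesic p q (fpt (spin_proj A)) (fr1 (spin_proj A)).

Definition complex_distance (p q : vec) (A B : 'M[C]_2) (d : C) : Prop :=
  [/\ adapted p q A, adapted p q B
    & exists A', spin_translate (fr1 (spin_proj A)) (complex.Re d) A A' /\
                 spin_rotate (fr1 (spin_proj A')) (complex.Im d) A' B].

Definition expC (z : C) : C :=
  Complex (expR (complex.Re z) * cos (complex.Im z))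
          (expR (complex.Re z) * sin (complex.Im z)).

Definition is_lambda_length (S1 S2 : spin_horosphere) (l : C) : Prop :=
  exists q1 q2 u1 u2 d,
    [/\ horosphere (hvec S1) q1, on_geodesic (hvec S1) (hvec S2) q1 u1,
        horosphere (hvec S2) q2, on_geodesic (hvec S1) (hvec S2) q2 u2
      & complex_distance (hvec S1) (hvec S2) (Win S1 q1) (Wout S2 q2) d /\
        l = expC (d / 2)].

(* xget selects the (unique) value; its default 0 is never used when the centres
   are distinct. *)
Definition lambda_length (S1 S2 : spin_horosphere) : C :=
  if `[< same_ideal (hvec S1) (hvec S2) >] then 0
  else xget 0 [set l | is_lambda_length S1 S2 l].

End Spin.

(* The vertices are four distinct points at infinity; they may be coplanar. *)
Definition ideal_tetrahedron (R : realType) (p : 'I_4 -> 'rV[R]_4) : Prop :=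
  (forall i, light_cone (p i)) /\
  (forall i j, i != j -> ~ same_ideal (p i) (p j)).

(* Main.v *)
From HB Require Import structures.
Require Import Defs.
From mathcomp Require Import all_boot all_order all_algebra.
From mathcomp Require Import all_classical all_reals all_analysis.
From mathcomp.real_closed Require Import complex.
From mathcomp Require Import ring lra.

(** The proof assigns to every spin-decorated horosphere a vector kappa of C^2,
    its spinor, and shows that complex lambda length is, up to one constant, the
    area form:
      lambda_12 = i * det (kappa_2, kappa_1)
    (lemma [lambda_lengthE]).  The theorem is then the three-term Pluecker
    relation between the 2 x 2 minors of the 2 x 4 matrix whose columns are the
    four spinors.

    A spin frame is a matrix A = (a, b) of SL(2,C) with columns a and b; it sits
    at the point x with herm x = a a^* + b b^*, and its first vector f has
    herm f = a a^* - b b^*.  So x + f and x - f, the two ends of the geodesic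
    along f, are the rank one matrices 2 a a^* and 2 b b^*.  For an outward
    decoration of horosphere n one has x + f = n at each point x, so the first
    column of W^out(x) is determined by n up to a phase.  The field being
    parallel means that W^out(P x) = P W^out(x) up to sign for each parabolic P
    fixing n; continuity along one-parameter parabolic groups forces the sign to
    be +, and P fixes the first column.  Since these groups sweep out the
    horosphere, the first column of W^out is a constant, kappa
    ([outward_spinor_const]).

    Motions of spin frames are defined by lifting paths of frames.  Two lifts
    differ by a sign which is continuous, hence constant ([path_lift_unique]),
    and explicit lifts are right multiplications: a motion of complex length d
    along the first vector is multiplication by diag (e^(d/2), e^(-d/2))
    ([complex_distanceP]), and a rotation by pi about the second vector is
    multiplication by i sigma_1 ([spin_rotate2P]).  The latter gives
    W^in = (i b, i kappa).

    If finally A = W1^in(q1) = (c, i kappa_1) and B = W2^out(q2) =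
    (kappa_2, b_2) satisfy B = A diag (lambda, 1/lambda), then kappa_2 =
    lambda c, so that lambda = lambda det A = det (kappa_2, i kappa_1).  Such a
    lambda exists because two frames adapted to one geodesic differ by a
    diagonal matrix ([adapted_diag]) and the complex exponential is onto the
    nonzero numbers ([expC_surj]). *)

Set Implicit Arguments.
Unset Strict Implicit.
Unset Printing Implicit Defensive.

Import Order.TTheory GRing.Theory Num.Theory.
Import numFieldNormedType.Exports.
Local Open Scope classical_set_scope.
Local Open Scope ring_scope.

Local Notation "A ^h" := (map_mx conjc A)^T (at level 2, format "A ^h").
Local Notation Re := complex.Re.
Local Notation Im := complex.Im.

Definition e_ (R : realType) (k : 'I_4) : 'rV[R]_4 := delta_mx 0 k.
Local Notation e0 := (e_ _ 0).
Local Notation e1 := (e_ _ 1).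
Local Notation e2 := (e_ _ 2).
Local Notation e3 := (e_ _ 3).

Section SpinorCalculus.
Variable R : realType.
Local Notation C := (R[i]).
Local Notation vec := 'rV[R]_4.
Implicit Types (A B M : 'M[C]_2) (x y u v w n m : vec) (z : C).
Implicit Types (S : spin_horosphere R).

(** * Finite indices and small determinants *)

Lemma ord2_ind (P : 'I_2 -> Prop) : P 0 -> P 1 -> forall i, P i.
Proof.
move=> P0 P1 [[|[|//]] lti].
- by rewrite (_ : Ordinal _ = 0) //; apply/val_inj.
- by rewrite (_ : Ordinal _ = 1) //; apply/val_inj.
Qed.

Lemma ord4_ind (P : 'I_4 -> Prop) : P 0 -> P 1 -> P 2 -> P 3 -> forall i, P i.
Proof.
move=> P0 P1 P2 P3 [[|[|[|[|//]]]] lti].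
- by rewrite (_ : Ordinal _ = 0) //; apply/val_inj.
- by rewrite (_ : Ordinal _ = 1) //; apply/val_inj.
- by rewrite (_ : Ordinal _ = 2) //; apply/val_inj.
- by rewrite (_ : Ordinal _ = 3) //; apply/val_inj.
Qed.

Lemma mx2P A B : A 0 0 = B 0 0 -> A 0 1 = B 0 1 -> A 1 0 = B 1 0 ->
  A 1 1 = B 1 1 -> A = B.
Proof. by move=> ????; apply/matrixP; elim/ord2_ind; elim/ord2_ind. Qed.

Lemma vec4P u v : u 0 0 = v 0 0 -> u 0 1 = v 0 1 -> u 0 2 = v 0 2 ->
  u 0 3 = v 0 3 -> u = v.
Proof. by move=> ????; apply/rowP; elim/ord4_ind. Qed.

Lemma sum_ord2 (V : nmodType) (F : 'I_2 -> V) : \sum_(i < 2) F i = F 0 + F 1.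
Proof.
by rewrite !big_ord_recl big_ord0 addr0; congr (_ + F _); apply/val_inj.
Qed.

Lemma sum_ord4 (V : nmodType) (F : 'I_4 -> V) :
  \sum_(i < 4) F i = F 0 + F 1 + F 2 + F 3.
Proof.
rewrite !big_ord_recl big_ord0 addr0 !addrA.
by congr (_ + F _ + F _ + F _); apply/val_inj.
Qed.

Lemma mul2E A B i j : (A *m B) i j = A i 0 * B 0 j + A i 1 * B 1 j.
Proof. by rewrite mxE sum_ord2. Qed.

Lemma lift01 : lift 0 0 = 1 :> 'I_2. Proof. exact/val_inj. Qed.

Lemma lift10 : lift 1 0 = 0 :> 'I_2. Proof. exact/val_inj. Qed.

Lemma det2E (K : comNzRingType) (A : 'M[K]_2) :
  \det A = A 0 0 * A 1 1 - A 0 1 * A 1 0.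
Proof.
rewrite (expand_det_row _ 0) !big_ord_recl big_ord0 /cofactor !det_mx11 !mxE.
by rewrite !lift01 !lift10 /= addr0 expr0 expr1 mul1r mulN1r mulrN.
Qed.

Lemma det3E (K : comNzRingType) (A : 'M[K]_3) : \det A =
  A 0 0 * (A 1 1 * A 2 2 - A 1 2 * A 2 1)
  - A 0 1 * (A 1 0 * A 2 2 - A 1 2 * A 2 0)
  + A 0 2 * (A 1 0 * A 2 1 - A 1 1 * A 2 0).
Proof.
(* Entries are read at natural numbers, where lifted indices compute. *)
pose a (i j : nat) := A (inord i) (inord j).
have AE i j : A i j = a i j by rewrite /a !inord_val.
rewrite (expand_det_row _ 0) !big_ord_recl big_ord0.
rewrite /cofactor !det2E !mxE !AE /=.
by rewrite /bump /=; ring.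
Qed.

Lemma det4E (K : comNzRingType) (A : 'M[K]_4) : \det A =
  A 0 0 * (A 1 1 * (A 2 2 * A 3 3 - A 2 3 * A 3 2)
           - A 1 2 * (A 2 1 * A 3 3 - A 2 3 * A 3 1)
           + A 1 3 * (A 2 1 * A 3 2 - A 2 2 * A 3 1))
  - A 0 1 * (A 1 0 * (A 2 2 * A 3 3 - A 2 3 * A 3 2)
           - A 1 2 * (A 2 0 * A 3 3 - A 2 3 * A 3 0)
           + A 1 3 * (A 2 0 * A 3 2 - A 2 2 * A 3 0))
  + A 0 2 * (A 1 0 * (A 2 1 * A 3 3 - A 2 3 * A 3 1)
           - A 1 1 * (A 2 0 * A 3 3 - A 2 3 * A 3 0)
           + A 1 3 * (A 2 0 * A 3 1 - A 2 1 * A 3 0))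
  - A 0 3 * (A 1 0 * (A 2 1 * A 3 2 - A 2 2 * A 3 1)
           - A 1 1 * (A 2 0 * A 3 2 - A 2 2 * A 3 0)
           + A 1 2 * (A 2 0 * A 3 1 - A 2 1 * A 3 0)).
Proof.
pose a (i j : nat) := A (inord i) (inord j).
have AE i j : A i j = a i j by rewrite /a !inord_val.
rewrite (expand_det_row _ 0) !big_ord_recl big_ord0.
rewrite /cofactor !det3E !mxE !AE /=.
by rewrite /bump /=; ring.
Qed.

Lemma mxtrace2 A : \tr A = A 0 0 + A 1 1.
Proof. exact: sum_ord2. Qed.

(** * The Minkowski form and the cross product *)

Lemma lorE x y : lor x y =
  - (x 0 0 * y 0 0) + x 0 1 * y 0 1 + x 0 2 * y 0 2 + x 0 3 * y 0 3.
Proof. by []. Qed.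

Lemma lorC x y : lor x y = lor y x.
Proof. by rewrite /lor; ring. Qed.

Lemma lorZl a x y : lor (a *: x) y = a * lor x y.
Proof. by rewrite /lor !mxE; ring. Qed.

Lemma lorDl x y w : lor (x + y) w = lor x w + lor y w.
Proof. by rewrite /lor !mxE; ring. Qed.

Lemma lorNl x w : lor (- x) w = - lor x w.
Proof. by rewrite /lor !mxE; ring. Qed.

Lemma lorZr a x y : lor y (a *: x) = a * lor y x.
Proof. by rewrite /lor !mxE; ring. Qed.

Lemma lorDr x y w : lor w (x + y) = lor w x + lor w y.
Proof. by rewrite /lor !mxE; ring. Qed.

Lemma lorNr x w : lor w (- x) = - lor w x.
Proof. by rewrite /lor !mxE; ring. Qed.

Lemma lor_polar x y : lor x y = (lor (x + y) (x + y) - lor x x - lor y y) / 2.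
Proof. by rewrite !lorDl !lorDr (lorC y x); field. Qed.

Lemma lor_base :
  [/\ lor e0 e0 = -1 :> R, lor e3 e3 = 1 :> R & lor e0 e3 = 0 :> R].
Proof. by split; rewrite /lor !mxE /=; ring. Qed.

Lemma lor_nondeg u v : (forall w, lor u w = lor v w) -> u = v.
Proof.
move=> H; apply/vec4P.
- by have := H e0; rewrite /lor !mxE /=; lra.
- by have := H e1; rewrite /lor !mxE /=; lra.
- by have := H e2; rewrite /lor !mxE /=; lra.
- by have := H e3; rewrite /lor !mxE /=; lra.
Qed.

Lemma crossxx x u : cross x u u = 0.
Proof.
apply/rowP => j; rewrite !mxE.
rewrite (determinant_alternate (i1 := 1) (i2 := 2)) ?mulr0 //.
by move=> k; rewrite !mxE.
Qed.

Lemma cross_e0 u v : cross e0 u v = \row_j nth 0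
  [:: 0; u 0 2 * v 0 3 - u 0 3 * v 0 2; u 0 3 * v 0 1 - u 0 1 * v 0 3;
      u 0 1 * v 0 2 - u 0 2 * v 0 1] j.
Proof. by apply/vec4P; rewrite !mxE det4E !mxE /=; ring. Qed.

Lemma cross_base :
  [/\ cross e0 e3 e1 = e2 :> vec, cross e0 e3 e2 = - e1 :> vec,
      cross e0 e1 e2 = e3 :> vec & cross e0 e1 e3 = - e2 :> vec].
Proof. by split; rewrite cross_e0; apply/vec4P; rewrite !mxE /=; ring. Qed.

(** Expansion along the last row; its minors are the coordinates of the cross
    product, up to the sign of the time coordinate. *)
Lemma lor_cross x u v w : lor (cross x u v) w = \det (mat_of_rows x u v w).
Proof.
pose co j := cofactor (mat_of_rows x u v w) 3 j.
have crossE j : cross x u v 0 j = (if j == 0 then -1 else 1) * co j.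
  rewrite mxE; congr (_ * _); rewrite (expand_det_row _ 3) (bigD1 j) //=.
  rewrite [mat_of_rows _ _ _ _ 3 j]mxE [delta_mx _ _ _ _]mxE !eqxx mul1r.
  rewrite big1 ?addr0 => [|k kj].
    congr (_ * _); congr (\det _); apply/matrixP => a b; rewrite !mxE.
    by case: a => [[|[|[|]]]].
  rewrite [mat_of_rows _ _ _ _ 3 k]mxE [delta_mx _ _ _ _]mxE (negPf kj) andbF.
  by rewrite mul0r.
by rewrite (expand_det_row _ 3) sum_ord4 !mxE /= lorE !crossE /= /co; ring.
Qed.

(** Both sides pair with w g to det (x, u, v, w), as det g = 1. *)
Lemma cross_isometry (g : 'M[R]_4) x u v :
  (forall y w, lor (y *m g) (w *m g) = lor y w) -> \det g = 1 ->
  cross (x *m g) (u *m g) (v *m g) = cross x u v *m g.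
Proof.
move=> gL g1; apply: lor_nondeg => w.
have gU : g \in unitmx by rewrite unitmxE g1 unitr1.
rewrite -[w](mulmxKV gU) gL !lor_cross -[RHS]mulr1 -g1 -det_mulmx.
congr (\det _); apply/row_matrixP => i; rewrite row_mul; apply/rowP => j.
by rewrite !mxE; elim/ord4_ind: i => /=; rewrite !mxE; apply: eq_bigr => k _;
  rewrite !mxE.
Qed.

(** Taking determinants in g J g^T = J, where J is the Gram matrix of the
    form. *)
Lemma det_isometry (g : 'M[R]_4) :
  (forall x y, lor (x *m g) (y *m g) = lor x y) ->
  \det g * \det g = 1.
Proof.
move=> gL; pose J : 'M[R]_4 := diag_mx (\row_j (if j == 0 then -1 else 1)).
have JE x y : x *m J *m y^T = (lor x y)%:M.
  apply/matrixP => i j; rewrite !ord1 mul_mx_diag !mxE lorE sum_ord4 !mxE /=.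
  by ring.
have : g *m J *m g^T = J.
  apply/row_matrixP => i; apply/rowP => j.
  have ev (M : 'M[R]_4) : row i M 0 j = (e_ R i *m M *m (e_ R j)^T) 0 0.
    by rewrite /e_ trmx_delta -rowE -colE !mxE.
  rewrite !ev; congr (_ _ 0 0).
  by rewrite JE -gL -JE trmx_mul !mulmxA.
move=> /(congr1 determinant); rewrite !det_mulmx det_tr mulrAC -[RHS]mul1r.
apply: mulIf; rewrite det_diag; apply/prodf_neq0 => i _; rewrite !mxE.
by case: ifP; rewrite ?oppr_eq0 oner_eq0.
Qed.

(** The combination v of n and m with zero time coordinate is spacelike, and
    lor v v is a negative multiple of lor n m; equality forces v = 0, that is,
    proportionality of n and m. *)
Lemma lor_light_lt0 n m :
  light_cone n -> light_cone m -> ~ same_ideal n m -> lor n m < 0.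
Proof.
move=> [nn n0] [mm m0] nm; pose v := m 0 0 *: n - n 0 0 *: m.
have v0 : v 0 0 = 0 by rewrite !mxE mulrC subrr.
have vv : lor v v = - (2 * n 0 0 * m 0 0) * lor n m.
  by rewrite /v !(lorDl, lorDr, lorNl, lorNr, lorZl, lorZr) nn mm (lorC m n);
    ring.
have pos : 0 < 2 * n 0 0 * m 0 0 by rewrite !mulr_gt0.
move: vv; rewrite lorE v0 mulr0 oppr0 add0r => vv.
have s1 := sqr_ge0 (v 0 1); have s2 := sqr_ge0 (v 0 2).
have s3 := sqr_ge0 (v 0 3).
rewrite lt_neqAle; apply/andP; split; last first.
  by rewrite -(ler_pM2l pos) mulr0; lra.
apply/negP => /eqP l0; apply: nm; exists (m 0 0 / n 0 0).
split; first by rewrite divr_gt0.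
rewrite l0 mulr0 in vv.
have z (a : R) : a ^+ 2 = 0 -> a = 0 by move/eqP; rewrite sqrf_eq0 => /eqP.
have vE : v = 0 by apply/vec4P; rewrite [RHS]mxE ?v0 //; apply: z; lra.
move/eqP: vE; rewrite /v subr_eq0 => /eqP E.
by rewrite mulrC -scalerA E scalerA mulVf ?scale1r // gt_eqF.
Qed.

(** * Complex numbers in coordinates *)

Lemma ReM (a b : C) : Re (a * b) = Re a * Re b - Im a * Im b.
Proof. by case: a; case: b. Qed.

Lemma ImM (a b : C) : Im (a * b) = Re a * Im b + Im a * Re b.
Proof. by case: a; case: b. Qed.

Lemma ReD (a b : C) : Re (a + b) = Re a + Re b.
Proof. by case: a; case: b. Qed.

Lemma ImD (a b : C) : Im (a + b) = Im a + Im b.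
Proof. by case: a; case: b. Qed.

Lemma ReN (a : C) : Re (- a) = - Re a.
Proof. by case: a. Qed.

Lemma ImN (a : C) : Im (- a) = - Im a.
Proof. by case: a. Qed.

Definition ReImE := (ReM, ImM, ReD, ImD, ReN, ImN).

Lemma complexP (a b : C) : Re a = Re b -> Im a = Im b -> a = b.
Proof. by case: a => ? ?; case: b => ? ? /= -> ->. Qed.

Lemma mulcJ_eq0 z : z * conjc z = 0 -> z = 0.
Proof. by move/eqP; rewrite mulf_eq0 conjc_eq0 orbb => /eqP. Qed.

Lemma expCD (a b : C) : expC (a + b) = expC a * expC b.
Proof.
case: a => a a'; case: b => b b'; rewrite /expC /= expRD cosD sinD.
by apply: complexP; rewrite ReImE /=; ring.
Qed.

Lemma expC0 : expC (0 : C) = 1.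
Proof. by rewrite /expC /= expR0 cos0 sin0 mulr1 mulr0. Qed.

Lemma expCV (e : C) : expC e * expC (- e) = 1.
Proof. by rewrite -expCD subrr expC0. Qed.

Lemma conj_expC (e : C) : conjc (expC e) = expC (conjc e).
Proof. by case: e => a b; rewrite /expC /= cosN sinN mulrN. Qed.

(** Polar coordinates; the angle is plus or minus an arc cosine. *)
Lemma expC_surj (z : C) : z != 0 -> exists e, expC e = z.
Proof.
case: z => a b z0; pose r := Num.sqrt (a ^+ 2 + b ^+ 2).
have s0 : 0 < a ^+ 2 + b ^+ 2.
  rewrite lt_neqAle addr_ge0 ?sqr_ge0 // andbT eq_sym paddr_eq0 ?sqr_ge0 //.
  by rewrite !sqrf_eq0; apply: contra z0 => /andP[/eqP-> /eqP->].
have r0 : 0 < r by rewrite sqrtr_gt0.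
have rE : r ^+ 2 = a ^+ 2 + b ^+ 2 by rewrite sqr_sqrtr // ltW.
have ar : -1 <= a / r <= 1.
  by rewrite ler_pdivlMr // ler_pdivrMr //; apply/andP; split;
    have := sqr_ge0 b; nra.
pose t := if 0 <= b then acos (a / r) else - acos (a / r).
have ct : cos t = a / r.
  by rewrite /t; case: ifP => _; rewrite ?cosN acosK // in_itv.
have st : sin t = b / r.
  have sE : sin (acos (a / r)) = `|b| / r.
    rewrite sin_acos // -[RHS]ger0_norm ?divr_ge0 // ?(ltW r0) // -sqrtr_sqr.
    congr Num.sqrt; rewrite !exprMn real_normK ?num_real // exprVn.
    by rewrite rE; field; lra.
  rewrite /t; case: (lerP 0 b) => b0; first by rewrite sE ger0_norm.
  by rewrite sinN sE ltr0_norm // mulNr opprK.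
exists (Complex (ln r) t); rewrite /expC /= lnK ?posrE // ct st.
by congr Complex; field; lra.
Qed.

(** * Hermitian matrices *)

Lemma mx22e (a b c d : C) : (mx22 a b c d 0 0 = a) * (mx22 a b c d 0 1 = b) *
  (mx22 a b c d 1 0 = c) * (mx22 a b c d 1 1 = d).
Proof. by rewrite !mxE. Qed.

Lemma mx22_1 : mx22 1 0 0 1 = 1%:M :> 'M[C]_2.
Proof. by apply: mx2P; rewrite !mxE. Qed.

Lemma det_mx22 (a b c d : C) : \det (mx22 a b c d) = a * d - b * c.
Proof. by rewrite det2E !mxE. Qed.

Lemma conj_mx22 (a b c d : C) :
  (mx22 a b c d)^h = mx22 (conjc a) (conjc c) (conjc b) (conjc d).
Proof. by apply: mx2P; rewrite !mxE. Qed.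

Lemma conjmxE M i j : (M^h) i j = conjc (M j i).
Proof. by rewrite !mxE. Qed.

Lemma conjmxM A B : (A *m B)^h = B^h *m A^h.
Proof. by rewrite map_mxM trmx_mul. Qed.

Lemma conjmxK A : (A^h)^h = A.
Proof. by apply/matrixP => i j; rewrite !mxE conjcK. Qed.

Lemma det_conj A : \det (A^h) = conjc (\det A).
Proof. by rewrite det_tr det_map_mx. Qed.

Lemma herm_conj v : (herm v)^h = herm v.
Proof.
by apply: mx2P; rewrite !mxE /= ?oppr0 ?opprK.
Qed.

Lemma hermK : cancel (@herm R) (@unherm R).
Proof.
by move=> v; apply/vec4P; rewrite !mxE /=; field.
Qed.

Lemma unhermK M : M^h = M -> herm (unherm M) = M.
Proof.
move=> SE; have {}SE i j : conjc (M j i) = M i j by rewrite -{2}SE !mxE.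
apply: mx2P; rewrite !mxE /=.
- have := SE 0 0; case: (M 0 0) => [a b] /= [bE].
  by congr Complex; [by field | lra].
- by case: (M 0 1).
- by rewrite -(SE 1 0); case: (M 0 1).
- have := SE 1 1; case: (M 1 1) => [a b] /= [bE].
  by congr Complex; [by field | lra].
Qed.

Lemma herm_inj : injective (@herm R).
Proof. exact: can_inj hermK. Qed.

Lemma hermD u v : herm (u + v) = herm u + herm v.
Proof.
by apply: mx2P; rewrite !mxE /=; congr Complex; ring.
Qed.

Lemma hermZ a v : herm (a *: v) = (a%:C)%C *: herm v.
Proof.
by apply: mx2P; rewrite !mxE /=; congr Complex; ring.
Qed.

Lemma herm_base : [/\ herm (e_ R 0) = 1%:M, herm (e_ R 1) = mx22 0 1 1 0 &
  herm (e_ R 3) = mx22 1 0 0 (-1)].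
Proof.
by split; apply: mx2P; rewrite !mxE /= ?mulr1n ?mulr0n;
  apply: complexP => /=; ring.
Qed.

Lemma herm_light :
  herm (e0 + e3 : vec) = mx22 2 0 0 0 /\ herm (e0 - e3 : vec) = mx22 0 0 0 2.
Proof.
by split; apply: mx2P; rewrite !mxE /=; apply: complexP => /=; ring.
Qed.

Lemma herm_coord v : v 0 0 = (Re (herm v 0 0) + Re (herm v 1 1)) / 2.
Proof. by rewrite !mxE /=; field. Qed.

Lemma det_herm v : \det (herm v) = ((- lor v v)%:C)%C.
Proof.
by rewrite det2E !mxE /= /lor; congr Complex; ring.
Qed.

(** * The action of SL(2,C) on Minkowski space *)

(** The action is sealed, so that matching never unfolds it to coordinates; it
    is handled through [herm_act], which describes it by A H A^*. *)
Definition act : 'M[C]_2 -> vec -> vec := locked (@spin_act R).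

Lemma spin_actE : @spin_act R = act.
Proof. by rewrite /act -lock. Qed.

Lemma herm_act A v : herm (act A v) = A *m herm v *m A^h.
Proof.
by rewrite -spin_actE /spin_act unhermK // !conjmxM conjmxK herm_conj mulmxA.
Qed.

Lemma act1 v : act 1%:M v = v.
Proof.
by apply: herm_inj; rewrite herm_act mul1mx map_mx1 trmx1 mulmx1.
Qed.

Lemma actM A B v : act (A *m B) v = act A (act B v).
Proof. by apply: herm_inj; rewrite !herm_act conjmxM !mulmxA. Qed.

Lemma actN A v : act (- A) v = act A v.
Proof.
by apply: herm_inj; rewrite !herm_act !mulNmx map_mxN linearN /= mulmxN opprK.
Qed.

Lemma actD A u v : act A (u + v) = act A u + act A v.
Proof.
by apply: herm_inj; rewrite [RHS]hermD !herm_act hermD mulmxDr mulmxDl.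
Qed.

Lemma actZ A a v : act A (a *: v) = a *: act A v.
Proof.
by apply: herm_inj; rewrite [RHS]hermZ !herm_act hermZ -scalemxAr -scalemxAl.
Qed.

Lemma act_is_linear A : linear (act A).
Proof. by move=> a u v; rewrite actD actZ. Qed.

HB.instance Definition _ A := GRing.isLinear.Build R vec vec *:%R (act A)
  (act_is_linear A).

Lemma act_oppr A v : act A (- v) = - act A v.
Proof. exact: raddfN. Qed.

(** By polarization, since A H A^* and H have the same determinant. *)
Lemma act_lor A x y : \det A = 1 -> lor (act A x) (act A y) = lor x y.
Proof.
move=> A1; suff H w : lor (act A w) (act A w) = lor w w.
  by rewrite [LHS]lor_polar -actD !H -lor_polar.
apply: oppr_inj; apply: (@complexI R).
by rewrite -!det_herm herm_act !det_mulmx det_conj A1 conjc1 mulr1 mul1r.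
Qed.

Lemma det_invmx A : \det A = 1 -> \det (invmx A) = 1.
Proof. by move=> A1; rewrite det_inv A1 invr1. Qed.

Lemma act_inv A v : \det A = 1 -> act A (act (invmx A) v) = v.
Proof. by move=> A1; rewrite -actM mulmxV ?act1 // unitmxE A1 unitr1. Qed.

Lemma spin_projE A :
  spin_proj A = Frame (act A e0) (act A e3) (act A e1) (act A e2).
Proof. by rewrite /spin_proj spin_actE. Qed.

Definition spin_mx A : 'M[R]_4 := lin1_mx (act A).

Lemma mul_spin_mx A v : v *m spin_mx A = act A v.
Proof. by rewrite mul_rV_lin1. Qed.

Lemma spin_mxM A B : spin_mx (A *m B) = spin_mx B *m spin_mx A.
Proof.
by apply/row_matrixP => i; rewrite !rowE mulmxA !mul_spin_mx actM.
Qed.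

Lemma spin_mxN A : spin_mx (- A) = spin_mx A.
Proof. by apply/row_matrixP => i; rewrite !rowE !mul_spin_mx actN. Qed.

Lemma spin_mx_lor A : \det A = 1 ->
  forall x y, lor (x *m spin_mx A) (y *m spin_mx A) = lor x y.
Proof. by move=> A1 x y; rewrite !mul_spin_mx act_lor. Qed.

Lemma Cayley_Hamilton2 A : A *m A = \tr A *: A - (\det A)%:M.
Proof.
by apply: mx2P; rewrite mul2E !mxE det2E mxtrace2 /= ?mulr1n ?mulr0n; ring.
Qed.

(** By Cayley-Hamilton, (A + 1)^2 = (tr A + 2) A, which makes A a square unless
    tr A = -2; in that case the same identity applies to - A. *)
Lemma SL2_square A : \det A = 1 ->
  exists B, \det B = 1 /\ (A = B *m B \/ A = - (B *m B)).
Proof.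
move=> A1.
have sq (A' : 'M[C]_2) : \det A' = 1 -> \tr A' + 2 != 0 ->
    exists B, \det B = 1 /\ A' = B *m B.
  move=> A'1 t0; set t := \tr A' in t0.
  exists ((sqrtc (t + 2))^-1 *: (A' + 1%:M)); split.
    rewrite detZ exprVn sqr_sqrtc -[RHS](mulVf t0); congr (_ * _).
    rewrite -[RHS]addrC -[X in X + t](_ : \det A' + 1 = 2); last by rewrite A'1.
    by rewrite /t !det2E mxtrace2 !mxE /= ?mulr1n ?mulr0n; ring.
  rewrite -scalemxAl -scalemxAr scalerA -expr2 exprVn sqr_sqrtc.
  rewrite mulmxDl mulmxDr mul1mx mulmx1 Cayley_Hamilton2 A'1 -/t.
  rewrite [X in _ *: X](_ : _ = (t + 2) *: A'); last first.
    rewrite scalerDl -[2]/(1 + 1) scalerDl !scale1r -!addrA; congr (_ + _).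
    by rewrite [A' + 1%:M]addrC [A' + (_ + _)]addrCA addKr.
  by rewrite scalerA mulVf // scale1r.
have [t0|t0] := eqVneq (\tr A + 2) 0; last first.
  by have [B [B1 AE]] := sq A A1 t0; exists B; split => //; left.
have N1 : \det (- A) = 1 by rewrite -scaleN1r detZ sqrrN expr1n mul1r.
have [|B [B1 AE]] := sq (- A) N1.
  rewrite raddfN /=; have -> : \tr A = - 2 by apply/eqP; rewrite -addr_eq0 t0.
  by rewrite opprK -natrD pnatr_eq0.
by exists B; split => //; right; rewrite -AE opprK.
Qed.

(** Orientation is preserved because A is a square up to sign: the determinant
    is the square of that of an isometry. *)
Lemma det_spin_mx A : \det A = 1 -> \det (spin_mx A) = 1.
Proof.
move=> /SL2_square[B [B1 AE]].
have -> : spin_mx A = spin_mx B *m spin_mx B.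
  by rewrite -spin_mxM; case: AE => ->; rewrite ?spin_mxN.
by rewrite det_mulmx; exact/det_isometry/spin_mx_lor.
Qed.

Lemma act_cross A x u v : \det A = 1 ->
  cross (act A x) (act A u) (act A v) = act A (cross x u v).
Proof.
move=> A1; rewrite -!mul_spin_mx cross_isometry //.
  exact: spin_mx_lor.
exact: det_spin_mx.
Qed.

Lemma transl_act A x v s y : \det A = 1 ->
  transl (act A x) (act A v) s (act A y) = act A (transl x v s y).
Proof.
move=> A1; rewrite /transl (act_lor y x A1) (act_lor y v A1).
by rewrite !(actD, actZ, act_oppr).
Qed.

Lemma rot_act A x v t u : \det A = 1 ->
  Defs.rot (act A x) (act A v) t (act A u) = act A (Defs.rot x v t u).
Proof.
by move=> A1; rewrite /Defs.rot (act_lor u v A1) act_cross // !(actD, actZ).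
Qed.

(** The Euclidean inner product of R^8 = C^4. *)
Definition mx_inner A B : R :=
  (Re (A 0 0) * Re (B 0 0) + Im (A 0 0) * Im (B 0 0)) +
  (Re (A 0 1) * Re (B 0 1) + Im (A 0 1) * Im (B 0 1)) +
  (Re (A 1 0) * Re (B 1 0) + Im (A 1 0) * Im (B 1 0)) +
  (Re (A 1 1) * Re (B 1 1) + Im (A 1 1) * Im (B 1 1)).

Lemma mx_innerN A B : mx_inner A (- B) = - mx_inner A B.
Proof. by rewrite /mx_inner !mxE !ReImE; ring. Qed.

(** 2 = 2 Re (det A) is at most the squared norm of A. *)
Lemma mx_inner_gt0 A : \det A = 1 -> 0 < mx_inner A A.
Proof.
rewrite det2E => /(congr1 (@complex.Re R)); rewrite !ReImE /= /mx_inner => E.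
have := sqr_ge0 (Re (A 0 0) - Re (A 1 1)).
have := sqr_ge0 (Im (A 0 0) + Im (A 1 1)).
have := sqr_ge0 (Re (A 0 1) + Re (A 1 0)).
have := sqr_ge0 (Im (A 0 1) - Im (A 1 0)).
nra.
Qed.

(** The time coordinate of the vector with Hermitian matrix A A^* is half the
    squared norm of A. *)
Lemma act_e0_gt0 A : \det A = 1 -> 0 < act A e0 0 0.
Proof.
move=> A1; have [h _ _] := herm_base.
rewrite herm_coord herm_act h mulmx1 !mul2E !conjmxE divr_gt0 //.
rewrite (_ : _ + _ = mx_inner A A) ?mx_inner_gt0 // /mx_inner.
case: (A 0 0) (A 0 1) (A 1 0) (A 1 1) => ? ? [? ?] [? ?] [? ?] /=.
by ring.
Qed.

Lemma H3_act_e0 A : \det A = 1 -> H3 (act A e0).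
Proof.
move=> A1; split; last exact: act_e0_gt0.
by rewrite act_lor //; have [] := lor_base.
Qed.

(** Transitivity on hyperbolic space, by the triangular (Cholesky) factorization
    of a positive definite Hermitian matrix of determinant 1. *)
Lemma H3_orbit x : H3 x -> exists A, \det A = 1 /\ x = act A e0.
Proof.
rewrite /H3 /= /lor => -[xx x0].
pose q := x 0 0 - x 0 3.
have q0 : 0 < q.
  rewrite /q; have := sqr_ge0 (x 0 1); have := sqr_ge0 (x 0 2); nra.
pose s := Num.sqrt q; have s0 : 0 < s by rewrite sqrtr_gt0.
have ss : s * s = q by rewrite -expr2 sqr_sqrtr // ltW.
have sn0 : s != 0 by rewrite gt_eqF.
exists (mx22 (Complex s^-1 0) (Complex (x 0 1 / s) (x 0 2 / s))
             0               (Complex s 0)); split.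
  by rewrite det_mx22; apply: complexP; rewrite !ReImE /=; field.
have [h _ _] := herm_base.
apply: herm_inj; rewrite herm_act h mulmx1; apply: mx2P;
  rewrite !mul2E !conjmxE !mx22e ?mxE /=;
  apply: complexP; rewrite ?ReImE /=; try by field.
  have -> : x 0 0 + x 0 3 = (1 + x 0 1 ^+ 2 + x 0 2 ^+ 2) / q.
    apply: (mulIf (lt0r_neq0 q0)); rewrite divfK ?lt0r_neq0 // /q; lra.
  by rewrite -ss; field.
by rewrite -/q -ss; ring.
Qed.

Lemma H3_act A x : \det A = 1 -> H3 x -> H3 (act A x).
Proof.
move=> A1 /H3_orbit[B [B1 ->]]; rewrite -actM; apply: H3_act_e0.
by rewrite det_mulmx A1 B1 mulr1.
Qed.

Lemma isometry_spin_mx A : \det A = 1 -> isometry_or (spin_mx A).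
Proof.
move=> A1; split; first exact: spin_mx_lor.
  by move=> x Hx; rewrite mul_spin_mx; exact: H3_act.
exact: det_spin_mx.
Qed.

(** * Uniqueness of lifts to the spin frame bundle *)

(** The transition matrix from A to B fixes e0, so it is unitary; fixing also e3
    and e1, it commutes with the Pauli matrices sigma_3 and sigma_1, hence is
    scalar. *)
Lemma spin_frame_sign A B : \det A = 1 -> \det B = 1 ->
  act A e0 = act B e0 -> act A e1 = act B e1 ->
  act A e3 = act B e3 -> B = A \/ B = - A.
Proof.
move=> A1 B1 E0 E1 E3; have AU : A \in unitmx by rewrite unitmxE A1 unitr1.
pose M := invmx A *m B.
have BE : B = A *m M by rewrite /M mulKVmx.
have M1 : \det M = 1 by rewrite det_mulmx det_inv A1 B1 invr1 mulr1.
have fixM k : act A (e_ _ k) = act B (e_ _ k) -> act M (e_ _ k) = e_ _ k.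
  by move=> E; rewrite /M actM -E -actM mulVmx // act1.
have [h0 h1 h3] := herm_base.
clearbody M.
have /(congr1 (@herm R)) := fixM 0 E0; rewrite herm_act h0 mulmx1.
move=> /mulmx1C MM.
have comm k : act A (e_ _ k) = act B (e_ _ k) ->
    M *m herm (e_ _ k) = herm (e_ _ k) *m M.
  move=> /fixM /(congr1 (@herm R)); rewrite herm_act => /(congr1 (mulmx^~ M)).
  by rewrite /= -[M *m _ *m _ *m _]mulmxA MM mulmx1.
have := comm 1 E1; have := comm 3 E3; rewrite h1 h3 => /matrixP C3 /matrixP C1.
have := C3 0 1; rewrite !mul2E !mxE /= => H01.
have := C3 1 0; rewrite !mul2E !mxE /= => H10.
have := C1 0 1; rewrite !mul2E !mxE /= => H11.
have eqN0 (z : C) : - z = z -> z = 0.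
  by move/eqP; rewrite eq_sym -addr_eq0 -mulr2n mulrn_eq0 => /orP[//|/eqP].
have ez := (mulr1, mulr0, mul0r, mul1r, addr0, add0r, mulrN1, mulN1r).
rewrite !ez in H01 H10 H11; move/eqN0 in H01; move/esym/eqN0 in H10.
move: M1; rewrite det2E H01 mul0r subr0 H11 => /eqP; rewrite -expr2 sqrf_eq1.
case/orP => /eqP m1; [left|right]; rewrite BE -[RHS]mulmx1.
  by congr (_ *m _); apply: mx2P; rewrite ?H11 ?H01 ?H10 ?m1 !mxE.
by rewrite mulNmx -mulmxN; congr (_ *m _); apply: mx2P;
  rewrite ?H11 ?H01 ?H10 ?m1 !mxE /= ?mulr1n ?mulr0n ?oppr0.
Qed.

Lemma spin_continuousM (T : topologicalType) (D : set T) A (W : T -> 'M[C]_2) :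
  spin_continuous D W -> spin_continuous D (fun t => A *m W t).
Proof.
move=> cW i j; have [[cR0 cI0] [cR1 cI1]] := (cW 0 j, cW 1 j).
split.
- rewrite (_ : (fun _ => _) = fun t =>
      (Re (A i 0) * Re (W t 0 j) - Im (A i 0) * Im (W t 0 j)) +
      (Re (A i 1) * Re (W t 1 j) - Im (A i 1) * Im (W t 1 j))); last first.
    by apply/funext => t; rewrite mul2E !ReImE.
  by move=> t; apply: cvgD; apply: cvgB; apply: cvgMr;
    [exact: cR0 | exact: cI0 | exact: cR1 | exact: cI1].
- rewrite (_ : (fun _ => _) = fun t =>
      (Re (A i 0) * Im (W t 0 j) + Im (A i 0) * Re (W t 0 j)) +
      (Re (A i 1) * Im (W t 1 j) + Im (A i 1) * Re (W t 1 j))); last first.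
    by apply/funext => t; rewrite mul2E !ReImE.
  by move=> t; apply: cvgD; apply: cvgD; apply: cvgMr;
    [exact: cI0 | exact: cR0 | exact: cI1 | exact: cR1].
Qed.

Lemma spin_continuous_mx22 (D : set R) (a b c d : R -> C) :
  [/\ continuous (fun t => Re (a t)), continuous (fun t => Re (b t)),
      continuous (fun t => Re (c t)) & continuous (fun t => Re (d t))] ->
  [/\ continuous (fun t => Im (a t)), continuous (fun t => Im (b t)),
      continuous (fun t => Im (c t)) & continuous (fun t => Im (d t))] ->
  spin_continuous D (fun t => mx22 (a t) (b t) (c t) (d t)).
Proof.
move=> [ra rb rc rd] [ia ib ic id] i j; split; apply: continuous_subspaceT;
  elim/ord2_ind: i; elim/ord2_ind: j.
all: by under eq_fun do rewrite mx22e; assumption.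
Qed.

Lemma spin_continuous_comp (D : set vec) (W : vec -> 'M[C]_2) (g : R -> vec)
    (E : set R) :
  spin_continuous D W -> continuous g -> (forall t, D (g t)) ->
  spin_continuous E (W \o g).
Proof.
move=> cW cg Dg.
have H (f : vec -> R) : {within D, continuous f} ->
    {within E, continuous (f \o g)}.
  move=> /subspace_continuousP cf; apply: continuous_subspaceT => t.
  apply: cvg_comp; last exact: (cf _ (Dg t)).
  move=> S; rewrite /within /= => nS.
  have nS1 : \forall r \near t, D (g r) -> S (g r) := cg t _ nS.
  by apply: filterS nS1 => r; apply; exact: Dg.
by move=> i j; have [cR cI] := cW i j; split; [exact: (H _ cR)|exact: (H _ cI)].
Qed.

(** The inner product of the two paths is continuous and equal to plus or minus
    the squared norm of w, so it never vanishes and keeps its sign. *)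
Lemma path_lift_unique (w w' : R -> 'M[C]_2) :
  spin_continuous (`[0, 1] : set R) w -> spin_continuous (`[0, 1] : set R) w' ->
  (forall t, 0 <= t <= 1 -> \det (w t) = 1 /\ (w' t = w t \/ w' t = - w t)) ->
  w' 0 = w 0 -> w' 1 = w 1.
Proof.
move=> cw cw' H E0.
have [|d1 [//|E1]] := H 1; first by rewrite ler01 lexx.
have [|d0 _] := H 0; first by rewrite ler01 lexx.
pose h t := mx_inner (w t) (w' t).
have ch : {within `[0, 1], continuous h}.
  have cD i j : {within `[0, 1], continuous (fun t =>
      Re (w t i j) * Re (w' t i j) + Im (w t i j) * Im (w' t i j))}.
    have [[a b] [c d]] := (cw i j, cw' i j).
    by move=> t; apply: cvgD; apply: cvgM;
      [exact: a | exact: c | exact: b | exact: d].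
  move=> t; apply: cvgD; last exact: cD.
  by apply: cvgD; last exact: cD; apply: cvgD; exact: cD.
have h0 : 0 < h 0 by rewrite /h E0 mx_inner_gt0.
have h1 : h 1 < 0 by rewrite /h E1 mx_innerN oppr_lt0 mx_inner_gt0.
have [|c c01 hc] := @IVT _ h 0 1 0 ler01 ch.
  by rewrite ge_min le_max (ltW h1) (ltW h0) orbT.
have [|dc Ec] := H c; first by move: c01; rewrite in_itv.
have := mx_inner_gt0 dc; case: Ec => Ec; move: hc; rewrite /h Ec ?mx_innerN.
  by move=> ->; rewrite ltxx.
by move/eqP; rewrite oppr_eq0 => /eqP ->; rewrite ltxx.
Qed.

(** Computes lifted motions: exhibiting one lift t |-> A (U t) of the motion Phi
    determines the endpoint of every lift starting at A. *)
Lemma spin_path_endpoint (Phi : R -> frame R) A B (U : R -> 'M[C]_2) :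
  \det A = 1 -> spin_continuous (`[0, 1] : set R) U ->
  (forall t, \det (U t) = 1) -> U 0 = 1%:M ->
  (forall t, spin_proj (A *m U t) = Phi t) ->
  spin_path Phi A B <-> B = A *m U 1.
Proof.
move=> A1 cU U1 U0 PhiE; have cAU := spin_continuousM A cU.
have dAU t : \det (A *m U t) = 1 by rewrite det_mulmx A1 U1 mulr1.
split=> [[w [cw wP w0 w1]]|->].
  rewrite -w1; apply: (path_lift_unique cAU cw) => [t /wP [wt wE]|]; last first.
    by rewrite w0 U0 mulmx1.
  split => //; move: wE; rewrite -PhiE /spin_proj spin_actE => -[E0 E3 E1 _].
  by apply: spin_frame_sign.
exists (fun t => A *m U t); split => //.
  by move=> t _; split; [exact: dAU|exact: PhiE].
by rewrite U0 mulmx1.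
Qed.

(** * Rotations and translations of spin frames *)

(** The lift of the screw motion of complex length 2 e along e3. *)
Definition screw (e : C) := mx22 (expC e) 0 0 (expC (- e)).

Lemma det_screw e : \det (screw e) = 1.
Proof. by rewrite det_mx22 expCV mulr0 subr0. Qed.

Lemma screw0 : screw 0 = 1%:M.
Proof. by rewrite /screw oppr0 expC0 mx22_1. Qed.

Lemma screwD a b : screw (a + b) = screw a *m screw b.
Proof.
by apply: mx2P; rewrite !mul2E !mxE /= ?opprD ?expCD; ring.
Qed.

(** The diagonal matrix screw e multiplies the diagonal entries of herm v by
    exp (2 x) and exp (- 2 x), and the off-diagonal ones by exp (2 i f) and its
    conjugate. *)
Lemma act_screw (x f : R) : let A := screw (Complex x f) in
 [/\ act A e0 = coshR (2 * x) *: e0 + sinhR (2 * x) *: e3,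
     act A e3 = sinhR (2 * x) *: e0 + coshR (2 * x) *: e3,
     act A e1 = cos (2 * f) *: e1 + sin (2 * f) *: e2 &
     act A e2 = cos (2 * f) *: e2 - sin (2 * f) *: e1].
Proof.
move=> A.
have actE v : herm (act A v) =
    mx22 (Complex (expR (2 * x)) 0 * herm v 0 0)
         (Complex (cos (2 * f)) (sin (2 * f)) * herm v 0 1)
         (Complex (cos (2 * f)) (- sin (2 * f)) * herm v 1 0)
         (Complex (expR (- (2 * x))) 0 * herm v 1 1).
  have eeE (a b u : C) : expC a * u * expC b = expC (a + b) * u.
    by rewrite expCD mulrAC.
  rewrite herm_act conj_mx22 !conj_expC conjc0.
  apply: mx2P; rewrite !mul2E !mx22e !(mul0r, mulr0, addr0, add0r) eeE;
    congr (_ * _); rewrite /expC /= ?opprK.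
  - by rewrite subrr cos0 sin0 mulr0 mulr1 mulr_natl mulr2n.
  - by rewrite subrr expR0 !mul1r mulr_natl mulr2n.
  - by rewrite addNr expR0 !mul1r -opprD cosN sinN mulr_natl mulr2n.
  - by rewrite addNr cos0 sin0 mulr0 mulr1 -opprD mulr_natl mulr2n.
by split; apply: herm_inj; rewrite actE; apply: mx2P; rewrite mx22e !mxE /=;
  apply: complexP; rewrite ?ReImE /= /coshR /sinhR; field.
Qed.

(** The lift exp (i f sigma_1) of the rotation by 2 f about e1. *)
Definition tilt (f : R) : 'M[C]_2 :=
  mx22 (Complex (cos f) 0) (Complex 0 (sin f))
       (Complex 0 (sin f)) (Complex (cos f) 0).

Lemma det_tilt f : \det (tilt f) = 1.
Proof.
by rewrite det_mx22; apply: complexP; rewrite !ReImE /=;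
  have := cos2Dsin2 f; lra.
Qed.

Lemma tilt0 : tilt 0 = 1%:M.
Proof. by rewrite /tilt cos0 sin0 mx22_1. Qed.

Lemma tilt_pihalf :
  tilt (pi / 2) = mx22 0 (Complex 0 1) (Complex 0 1) 0 :> 'M[C]_2.
Proof. by rewrite /tilt cos_pihalf sin_pihalf. Qed.

Lemma cos_double f : cos (2 * f) = cos f ^+ 2 - sin f ^+ 2 :> R.
Proof. by rewrite mulr_natl mulr2n cosD !expr2. Qed.

Lemma sin_double f : sin (2 * f) = 2 * cos f * sin f :> R.
Proof. by rewrite mulr_natl mulr2n sinD; ring. Qed.

Lemma act_tilt (f : R) : let A := tilt f in
 [/\ act A e0 = e0, act A e1 = e1,
     act A e2 = cos (2 * f) *: e2 + sin (2 * f) *: e3 &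
     act A e3 = cos (2 * f) *: e3 - sin (2 * f) *: e2].
Proof.
rewrite cos_double sin_double /=.
have cs := cos2Dsin2 f.
split; apply: herm_inj; rewrite herm_act conj_mx22; apply: mx2P;
  rewrite !mul2E !mx22e !mxE /=; apply: complexP; rewrite ?ReImE /=; lra.
Qed.

Lemma transl_base s :
  [/\ transl e0 e3 s e0 = coshR s *: e0 + sinhR s *: e3 :> vec,
  transl e0 e3 s e3 = sinhR s *: e0 + coshR s *: e3 :> vec,
  transl e0 e3 s e1 = e1 :> vec & transl e0 e3 s e2 = e2 :> vec].
Proof.
by split; apply/vec4P; rewrite /transl /lor !mxE /=; ring.
Qed.

Lemma rot_base t :
  [/\ Defs.rot e0 e3 t e3 = e3 :> vec,
      Defs.rot e0 e3 t e1 = cos t *: e1 + sin t *: e2 :> vec &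
      Defs.rot e0 e3 t e2 = cos t *: e2 - sin t *: e1 :> vec] /\
  [/\ Defs.rot e0 e1 t e1 = e1 :> vec,
      Defs.rot e0 e1 t e2 = cos t *: e2 + sin t *: e3 :> vec &
      Defs.rot e0 e1 t e3 = cos t *: e3 - sin t *: e2 :> vec].
Proof.
have [c1 c2 c3 c4] := cross_base.
by split; split; rewrite /Defs.rot ?crossxx ?c1 ?c2 ?c3 ?c4;
  apply/vec4P; rewrite /lor !mxE /=; ring.
Qed.

Lemma continuous_scale (s : R) : continuous (fun t : R => t * s).
Proof. by move=> t; apply: cvgMl; exact: cvg_id. Qed.

Lemma continuous_screw (a : C) (D : set R) :
  spin_continuous D (fun t : R => screw (t%:C%C * a)).
Proof.
have cE (b : C) : continuous (fun t : R => Re (expC (t%:C%C * b))) /\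
                  continuous (fun t : R => Im (expC (t%:C%C * b))).
  case: b => b c; rewrite /expC /=.
  have e1 t : t * b - 0 * c = t * b by ring.
  have e2 t : t * c + 0 * b = t * c by ring.
  split; under eq_fun do rewrite e1 e2; move=> t; apply: cvgM.
  - by apply: (continuous_comp (@continuous_scale b t)); exact: continuous_expR.
  - by apply: (continuous_comp (@continuous_scale c t)); exact: continuous_cos.
  - by apply: (continuous_comp (@continuous_scale b t)); exact: continuous_expR.
  - by apply: (continuous_comp (@continuous_scale c t)); exact: continuous_sin.
rewrite /screw; under eq_fun do rewrite -mulrN.
by apply: spin_continuous_mx22; split; try exact: cst_continuous;
  case: (cE a); case: (cE (-a)).
Qed.

Lemma continuous_tilt (s : R) (D : set R) :
  spin_continuous D (fun t : R => tilt (t * s)).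
Proof.
by apply: spin_continuous_mx22; split; try exact: cst_continuous; move=> t /=;
  apply: (continuous_comp (@continuous_scale s t));
  first [exact: continuous_cos|exact: continuous_sin].
Qed.

Lemma spin_translateP A B s : \det A = 1 ->
  spin_translate (fr1 (spin_proj A)) s A B <->
  B = A *m screw (Complex (s / 2) 0).
Proof.
move=> A1; rewrite /spin_translate; set Phi := fun _ => _.
rewrite (@spin_path_endpoint _ _ _
  (fun t : R => screw (t%:C%C * Complex (s / 2) 0))) //.
- by rewrite mul1r.
- exact: continuous_screw.
- by move=> t; exact: det_screw.
- by rewrite mul0r screw0.
move=> t; rewrite /Phi /translate_frame !spin_projE /= !transl_act // !actM.
have -> : t%:C%C * Complex (s / 2) 0 = Complex (t * s / 2) 0.
  by apply: complexP; rewrite ReImE /=; field.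
have [-> -> -> ->] := act_screw (t * s / 2) 0.
have -> : 2 * (t * s / 2) = t * s by field.
have [-> -> -> ->] := transl_base (t * s).
by rewrite mulr0 cos0 sin0 !scale1r !scale0r subr0 addr0.
Qed.

Lemma spin_rotate1P A B s : \det A = 1 ->
  spin_rotate (fr1 (spin_proj A)) s A B <-> B = A *m screw (Complex 0 (s / 2)).
Proof.
move=> A1; rewrite /spin_rotate; set Phi := fun _ => _.
rewrite (@spin_path_endpoint _ _ _
  (fun t : R => screw (t%:C%C * Complex 0 (s / 2)))) //.
- by rewrite mul1r.
- exact: continuous_screw.
- by move=> t; exact: det_screw.
- by rewrite mul0r screw0.
move=> t; rewrite /Phi /rotate_frame !spin_projE /= !rot_act // !actM.
have -> : t%:C%C * Complex 0 (s / 2) = Complex 0 (t * s / 2).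
  by apply: complexP; rewrite ReImE /=; field.
have [-> -> -> ->] := act_screw 0 (t * s / 2).
have -> : 2 * (t * s / 2) = t * s by field.
have [[-> -> ->] _] := rot_base (t * s).
have -> : coshR (2 * 0) = 1 :> R by rewrite /coshR mulr0 oppr0 expR0; field.
have -> : sinhR (2 * 0) = 0 :> R by rewrite /sinhR mulr0 oppr0 expR0; field.
by rewrite !scale1r !scale0r addr0 add0r.
Qed.

Lemma spin_rotate2P A B s : \det A = 1 ->
  spin_rotate (fr2 (spin_proj A)) s A B <-> B = A *m tilt (s / 2).
Proof.
move=> A1; rewrite /spin_rotate; set Phi := fun _ => _.
rewrite (@spin_path_endpoint _ _ _
  (fun t : R => tilt (t * (s / 2)))) //.
- by rewrite mul1r.
- exact: continuous_tilt.
- by move=> t; exact: det_tilt.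
- by rewrite mul0r tilt0.
move=> t; rewrite /Phi /rotate_frame !spin_projE /= !rot_act // !actM.
have [-> -> -> ->] := act_tilt (t * (s / 2)).
have -> : 2 * (t * (s / 2)) = t * s by field.
by have [_ [-> -> ->]] := rot_base (t * s).
Qed.

(** The complex distance, defined modulo 4 pi i through lifted motions, becomes
    an equation between matrices. *)
Lemma complex_distanceP (p q : vec) A B (d : C) :
  adapted p q A -> adapted p q B ->
  complex_distance p q A B d <-> B = A *m screw (d / 2).
Proof.
move=> aA aB; have A1 : \det A = 1 by case: aA.
have dE : d / 2 = Complex (Re d / 2) 0 + Complex 0 (Im d / 2).
  have -> : d = Complex (Re d) 0 + Complex 0 (Im d).
    by case: d => a b; apply: complexP; rewrite ReImE /= ?addr0 ?add0r.
  have h (a : C) : a / 2 = Complex (Re a / 2) (Im a / 2).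
    have n2 : (2 : C) != 0 by rewrite pnatr_eq0.
    apply: (mulIf n2); rewrite divfK //; apply: complexP; rewrite ReImE /=;
      by field.
  by rewrite mulrDl !h; apply: complexP; rewrite !ReImE /=; ring.
split=> [[_ _ [A']]|BE].
  rewrite spin_translateP // => -[A'E].
  have A'1 : \det A' = 1 by rewrite A'E det_mulmx A1 det_screw mulr1.
  by rewrite spin_rotate1P // A'E -mulmxA -screwD -dE.
split => //; exists (A *m screw (Complex (Re d / 2) 0));
  rewrite spin_translateP // spin_rotate1P.
  by rewrite -mulmxA -screwD -dE.
by rewrite det_mulmx A1 det_screw mulr1.
Qed.

(** * Parabolic isometries *)

(** The ray of e0 + e3 is the class of the first basis vector of C^2, so a
    matrix fixing this ray is upper triangular; it scales the ray
    by |M 0 0|^2. *)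
Lemma act_forward_light M (r : R) : act M (e0 + e3) = r *: (e0 + e3) ->
  M 1 0 = 0 /\ M 0 0 * conjc (M 0 0) = r%:C%C.
Proof.
have [h _] := herm_light; have two0 : (2 : C) != 0 by rewrite pnatr_eq0.
move=> /(congr1 (@herm R)); rewrite herm_act hermZ h => /matrixP E; split.
  apply: mulcJ_eq0; apply: (mulfI two0).
  by have := E 1 1; rewrite [RHS]mxE !mul2E !conjmxE !mx22e !mulr0 => <-; ring.
apply: (mulfI two0).
have := E 0 0; rewrite [RHS]mxE !mul2E !conjmxE !mx22e => E00.
by rewrite [RHS]mulrC -E00; ring.
Qed.

Lemma act_backward_light M (r : R) :
  act M (e0 - e3) = r *: (e0 - e3) -> M 0 1 = 0.
Proof.
have [_ h] := herm_light; have two0 : (2 : C) != 0 by rewrite pnatr_eq0.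
move=> /(congr1 (@herm R)); rewrite herm_act hermZ h => /matrixP E.
apply: mulcJ_eq0; apply: (mulfI two0).
by have := E 0 0; rewrite [RHS]mxE !mul2E !conjmxE !mx22e !mulr0 => <-; ring.
Qed.

(** The parabolic matrices fixing the ideal point of e0 + e3.  They also fix its
    spinor, the first basis vector of C^2. *)
Definition shear z := mx22 1 z 0 1.

Lemma det_shear z : \det (shear z) = 1.
Proof. by rewrite det_mx22 mulr1 mulr0 subr0. Qed.

Lemma shear0 : shear 0 = 1%:M.
Proof. exact: mx22_1. Qed.

(** The entries of herm v that detect the fixed points of a shear: the bottom
    right one vanishes only on multiples of e0 + e3 within the closed light
    cone. *)
Lemma herm_shear z v :
  herm (act (shear z) v) 1 1 = herm v 1 1 /\
  herm (act (shear z) v) 0 1 = herm v 0 1 + z * herm v 1 1.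
Proof.
rewrite herm_act !mul2E !conjmxE !mx22e conjc0 conjc1.
by split; ring.
Qed.

Lemma act_shear z :
  act (shear z) e0 =
  e0 + (Re z *: e1 + Im z *: e2) + ((Re z ^+ 2 + Im z ^+ 2) / 2) *: (e0 + e3).
Proof.
apply: herm_inj; rewrite herm_act; apply: mx2P;
  rewrite !mul2E !conjmxE !mx22e !mxE /=;
  case: z => a b; apply: complexP; rewrite !ReImE /=; by field.
Qed.

Lemma act_shear_light z : act (shear z) (e0 + e3) = e0 + e3.
Proof.
have [h _] := herm_light.
apply: herm_inj; rewrite herm_act h conj_mx22 conjc0 conjc1.
by apply: mx2P; rewrite !mul2E !mx22e; ring.
Qed.

(** By [act_shear] the path is a quadratic polynomial in t. *)
Lemma shear_path_continuous A z :
  continuous (fun t : R => act (A *m shear (t%:C%C * z)) e0).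
Proof.
pose a : vec := act A (Re z *: e1 + Im z *: e2).
pose b : vec := ((Re z ^+ 2 + Im z ^+ 2) / 2) *: act A (e0 + e3).
rewrite (_ : (fun _ => _) =
    fun t : R => (act A e0 + t *: a) + (t * t) *: b); last first.
  apply/funext => t; rewrite actM act_shear !actD !actZ /a /b ?actD ?actZ.
  rewrite !ReImE /= !scalerDr !scalerA.
  by congr (_ + (_ *: _ + _ *: _) + (_ *: _ + _ *: _)); field.
move=> t; apply: cvgD; first apply: cvgD; first exact: cvg_cst.
  exact: cvgZr_tmp.
by apply: cvgZr_tmp; apply: cvgM.
Qed.

(** In the coordinates given by A, an eigenvector v with eigenvalue c satisfies
    h = c h and w + z h = c w for the entries h = herm v 1 1 and w = herm v 0 1.
    If h were nonzero then c = 1 and z h = 0; so h = 0.  This excludes timelike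
    vectors and leaves only the ray of e0 + e3 on the light cone. *)
Lemma parabolic_shear A z n : \det A = 1 -> z != 0 ->
  act A (e0 + e3) = n -> 0 < n 0 0 ->
  parabolic (spin_mx (A *m shear z *m invmx A)).
Proof.
move=> A1 z0 An n0; pose P := A *m shear z *m invmx A.
have P1 : \det P = 1 by rewrite !det_mulmx A1 det_shear det_invmx // !mulr1.
have AU : A \in unitmx by rewrite unitmxE A1 unitr1.
have red (c : R) y : act P y = c *: y ->
    act (shear z) (act (invmx A) y) = c *: act (invmx A) y.
  by move=> E; rewrite -actZ -E /P -!actM !mulmxA mulVmx // mul1mx.
have key (c : R) v : c = 1 -> act (shear z) v = c *: v -> herm v 1 1 = 0.
  move=> -> E; have [_] := herm_shear z v; rewrite E scale1r.
  rewrite -[LHS]addr0 => /addrI/esym/eqP.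
  by rewrite mulf_eq0 (negPf z0) => /eqP.
have coord v : herm v 1 1 = 0 -> v 0 0 = v 0 3.
  by rewrite !mxE /= => -[/eqP]; rewrite subr_eq0 => /eqP.
split; first exact: isometry_spin_mx.
  move=> x [xx _]; rewrite mul_spin_mx => E.
  have := red 1 x; rewrite scale1r => /(_ E) /(key _ _ erefl) /coord cE.
  move: xx; rewrite -(act_lor x x (det_invmx A1)) lorE cE => xx.
  have := sqr_ge0 (act (invmx A) x 0 1).
  by have := sqr_ge0 (act (invmx A) x 0 2); nra.
exists n.
have nP : act P n = n.
  by rewrite -An -!actM mulmxKV // actM act_shear_light.
have nn : lor n n = 0 by rewrite -An act_lor // /lor !mxE /=; ring.
split; first by split.
  by exists 1; rewrite scale1r mul_spin_mx nP; split.
move=> q [qq q0] [c [c0]]; rewrite mul_spin_mx => /red E.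
set v := act (invmx A) q in E.
have vv : lor v v = 0 by rewrite act_lor ?det_invmx.
have v11 : herm v 1 1 = 0.
  have [H _] := herm_shear z v; move: H; rewrite E hermZ mxE => H.
  have [c1|c1] := eqVneq c 1; first exact: (key _ _ c1 E).
  move/eqP: H; rewrite -subr_eq0 -[X in _ - X]mul1r -mulrBl mulf_eq0.
  move=> /orP[|/eqP//].
  by rewrite subr_eq0 => /eqP[/eqP]; rewrite (negPf c1).
have v03 := coord _ v11; move: vv; rewrite lorE v03 => vv.
have s1 := sqr_ge0 (v 0 1); have s2 := sqr_ge0 (v 0 2).
have v1 : v 0 1 = 0 by apply/eqP; rewrite -sqrf_eq0; apply/eqP; lra.
have v2 : v 0 2 = 0 by apply/eqP; rewrite -sqrf_eq0; apply/eqP; lra.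
have vE : v = v 0 0 *: (e0 + e3).
  by apply/vec4P; rewrite !mxE /= ?v1 ?v2 ?v03; ring.
have qE : q = v 0 0 *: n by rewrite -An -actZ -vE act_inv.
exists (v 0 0); split => //.
by move: q0; rewrite qE mxE pmulr_lgt0.
Qed.

Lemma horosphere_stable n M : \det M = 1 -> act M n = n ->
  [set x *m spin_mx M | x in horosphere n] = horosphere n.
Proof.
move=> M1 Mn; apply/seteqP; split=> [_ [v [Hv vn] <-]|v [Hv vn]].
  by rewrite mul_spin_mx; split; [exact: H3_act|rewrite -[in LHS]Mn act_lor].
exists (act (invmx M) v); last by rewrite mul_spin_mx act_inv.
split; first by apply: H3_act; rewrite ?det_invmx.
by rewrite -(act_lor _ _ M1) act_inv // Mn.
Qed.

(** * The spinor of a spin-decorated horosphere *)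

(** Any two points x, y of the horosphere are joined by an orbit g of a
    one-parameter group of parabolic isometries fixing n.  The images w of the
    spin frame W x under this group lie over the frames of the decoration along
    g, because V is parallel; by unique path lifting, w ends at W y.  All
    matrices w t have the same first column. *)
Lemma outward_spinor_const n V W x y i :
  light_cone n -> unit_parallel_field n V ->
  spin_lift n (fout n V) W -> horosphere n x -> horosphere n y ->
  W y i 0 = W x i 0.
Proof.
move=> [_ n0] [[_ Vpar] _] [cW WP] hx hy.
have WE v : horosphere n v -> [/\ \det (W v) = 1, act (W v) e0 = v,
    act (W v) (e0 + e3) = n & act (W v) e1 = V v].
  move=> /WP[_ dW]; rewrite spin_projE => -[E0 E3 E1 _]; split => //.
  by rewrite actD E0 E3 /Nout addrC subrK.
have [A1 A0 A03 AV] := WE x hx; have [B1 B0 B03 _] := WE y hy.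
move: A1 A0 A03 AV B1 B0 B03; set A := W x; set B := W y.
move=> A1 A0 A03 AV B1 B0 B03.
have AU : A \in unitmx by rewrite unitmxE A1 unitr1.
pose M := invmx A *m B.
have BE : B = A *m M by rewrite /M mulKVmx.
have M1 : \det M = 1 by rewrite det_mulmx det_invmx // B1 mulr1.
have [M10 M00] : M 1 0 = 0 /\ M 0 0 * conjc (M 0 0) = (1 : R)%:C%C.
  apply: act_forward_light; rewrite scale1r /M actM B03 -A03 -actM mulVmx //.
  exact: act1.
clearbody M.
(* M fixes e0 + e3, so it is upper triangular with |M 0 0| = 1; the shear z
   takes up its off-diagonal entry, leaving a rotation that fixes e0. *)
pose z := M 0 1 * M 0 0.
have M11 : M 0 0 * M 1 1 = 1 by move: M1; rewrite det2E M10 mulr0 subr0.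
have ME : M = shear z *m mx22 (M 0 0) 0 0 (M 1 1).
  apply: mx2P;
    rewrite mul2E !mx22e ?M10 /z ?(mulr0, mul0r, mul1r, addr0, add0r) //.
  by rewrite -mulrA M11 mulr1.
have De0 : act (mx22 (M 0 0) 0 0 (M 1 1)) e0 = e0.
  have [h0 _ _] := herm_base.
  have M11' : M 1 1 * conjc (M 1 1) = 1.
    have : (M 0 0 * conjc (M 0 0)) * (M 1 1 * conjc (M 1 1)) = 1.
      by rewrite mulrACA -rmorphM M11 rmorph1 mulr1.
    by rewrite M00 mul1r.
  apply: herm_inj; rewrite herm_act h0 mulmx1 conj_mx22 conjc0.
  by apply: mx2P;
    rewrite mul2E !mx22e ?M00 ?M11' !mxE ?(mulr0, mul0r, addr0, add0r).
have yE : y = act (A *m shear z) e0 by rewrite -B0 BE ME !actM De0.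
pose w (t : R) := A *m shear (t%:C%C * z).
pose g (t : R) := act (w t) e0.
have dw t : \det (w t) = 1 by rewrite det_mulmx A1 det_shear mulr1.
have w03 t : act (w t) (e0 + e3) = n by rewrite actM act_shear_light.
have hg t : horosphere n (g t).
  split; first exact: H3_act_e0.
  by rewrite -(w03 t) act_lor // /lor !mxE /=; ring.
(* The isometry P moves x to g t and W x to w t. *)
have Vg t : act (w t) e1 = V (g t).
  have [E|tz] := eqVneq (t%:C%C * z) 0.
    by rewrite /g /w E shear0 mulmx1 A0.
  pose P := A *m shear (t%:C%C * z) *m invmx A.
  have PA : P *m A = w t by rewrite /P mulmxKV.
  have P1 : \det P = 1 by rewrite !det_mulmx A1 det_shear det_invmx // !mulr1.
  have Pn : act P n = n by rewrite -{1}A03 -actM PA w03.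
  have := Vpar _ (parabolic_shear A1 tz A03 n0) (horosphere_stable P1 Pn) x hx.
  by rewrite !mul_spin_mx -AV -{1}A0 -!actM PA => <-.
have Wg t : W (g t) = w t \/ W (g t) = - w t.
  have [d E0 E03 E1] := WE _ (hg t).
  apply: spin_frame_sign => //; first by rewrite E1.
  apply: (addrI (act (w t) e0)); rewrite -actD w03.
  by rewrite -[act (w t) e0]/(g t) -{1}E0 -actD E03.
have cw : spin_continuous (`[0, 1] : set R) w.
  apply: spin_continuousM; apply: spin_continuous_mx22; split;
    try exact: cst_continuous.
    rewrite (_ : (fun _ => _) = fun t => t * Re z); first
      by exact: continuous_scale.
    by apply/funext => t; rewrite ReM /=; ring.
  rewrite (_ : (fun _ => _) = fun t => t * Im z); first
      by exact: continuous_scale.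
  by apply/funext => t; rewrite ImM /=; ring.
have cWg : spin_continuous (`[0, 1] : set R) (W \o g).
  by apply: (spin_continuous_comp _ cW _ hg); exact: shear_path_continuous.
have W1 : W (g 1) = w 1.
  apply: (path_lift_unique cw cWg) => [t _|].
    by split; [exact: dw | exact: Wg].
  by rewrite /= /g /w mul0r shear0 mulmx1 A0.
move: W1; rewrite /g /w mul1r -yE -/B => ->.
by rewrite mul2E !mx22e mulr1 mulr0 addr0.
Qed.

(** The constant first column of the outward decoration, read off at an
    arbitrary point of the horosphere. *)
Definition spinor (S : spin_horosphere R) (i : 'I_2) : C :=
  Wout S (xget 0 (horosphere (hvec S))) i 0.

(** The inward decoration is W^out (i sigma_1), which exchanges the columns of
    W^out and multiplies them by i. *)
Lemma spinorP S x i : horosphere (hvec S) x ->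
  [/\ \det (Wout S x) = 1, \det (Win S x) = 1, Wout S x i 0 = spinor S i &
  Win S x i 1 = Complex 0 1 * spinor S i].
Proof.
move=> hx; have [[V' [_ [_ liftin]]] [V [Vpar lift]] rotW _] := decorationP S.
have [_ dW _] := lift.2 x hx; have [_ dWin _] := liftin x hx.
have WE : Wout S x i 0 = spinor S i.
  apply: (outward_spinor_const i (hvecP S) Vpar lift _ hx).
  exact: (xgetI 0 hx).
split => //; move: (rotW x hx); rewrite spin_rotate2P // tilt_pihalf => ->.
by rewrite mul2E !mx22e mulr0 addr0 WE mulrC.
Qed.

(** * Lambda lengths in terms of spinors *)

(** Both endpoints of a common geodesic are fixed by the transition matrix,
    which is thus both upper and lower triangular. *)
Lemma adapted_diag A B (r s : R) : \det A = 1 -> \det B = 1 ->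
  act B (e0 + e3) = r *: act A (e0 + e3) ->
  act B (e0 - e3) = s *: act A (e0 - e3) ->
  exists e, B = A *m screw e.
Proof.
move=> A1 B1 Ep Em; have AU : A \in unitmx by rewrite unitmxE A1 unitr1.
pose M := invmx A *m B.
have M1 : \det M = 1 by rewrite det_mulmx det_invmx // B1 mulr1.
have BE : B = A *m M by rewrite /M mulKVmx.
have [M10 _] : M 1 0 = 0 /\ M 0 0 * conjc (M 0 0) = r%:C%C.
  by apply: act_forward_light; rewrite /M actM Ep actZ -actM mulVmx // act1.
have M01 : M 0 1 = 0.
  apply: (@act_backward_light _ s).
  by rewrite /M actM Em actZ -actM mulVmx // act1.
have M11 : M 0 0 * M 1 1 = 1 by move: M1; rewrite det2E M10 mulr0 subr0.
have M0 : M 0 0 != 0.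
  by apply: contra_eqN M11 => /eqP ->; rewrite mul0r eq_sym oner_eq0.
have [e eE] := expC_surj M0.
exists e; rewrite BE; congr (_ *m _); apply: mx2P; rewrite mx22e //.
by apply: (mulfI M0); rewrite M11 -eE expCV.
Qed.

Lemma lambda_spinor S1 S2 l : is_lambda_length S1 S2 l ->
  l = Complex 0 1 * (spinor S2 0 * spinor S1 1 - spinor S2 1 * spinor S1 0).
Proof.
move=> [q1 [q2 [u1 [u2 [d [h1 _ h2 _ [dist ->]]]]]]].
have [aA aB _] := dist; move/(complex_distanceP _ aA aB): dist => BE.
have k2 i : Win S1 q1 i 0 * expC (d / 2) = spinor S2 i.
  by have [_ _ <- _] := spinorP i h2; rewrite BE mul2E !mx22e mulr0 addr0.
have k1 i : Win S1 q1 i 1 = Complex 0 1 * spinor S1 i.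
  by have [] := spinorP i h1.
have [_ A1 _ _] := spinorP 0 h1.
transitivity (expC (d / 2) * \det (Win S1 q1)); first by rewrite A1 mulr1.
by rewrite det2E !k1 -!k2; ring.
Qed.

(** With c = -1 / lor n1 n2, the geodesic between the centres meets the
    horospheres at n1 / 2 + c n2 and n2 / 2 + c n1, and the two decorations are
    adapted to it there. *)
Lemma lambda_exists S1 S2 : ~ same_ideal (hvec S1) (hvec S2) ->
  exists l, is_lambda_length S1 S2 l.
Proof.
move=> ns; have n12 := lor_light_lt0 (hvecP S1) (hvecP S2) ns.
have [[nn1 p1] [nn2 p2]] := (hvecP S1, hvecP S2).
set n1 := hvec S1 in n12 nn1 p1 *; set n2 := hvec S2 in n12 nn2 p2 *.
pose c := (- lor n1 n2)^-1; have c0 : 0 < c by rewrite invr_gt0 oppr_gt0.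
have cE : c * lor n1 n2 = -1 by rewrite /c invrN mulNr mulVf // lt_eqF.
pose q1 : vec := 2^-1 *: n1 + c *: n2; pose q2 : vec := 2^-1 *: n2 + c *: n1.
have lE := (lorDl, lorDr, lorZl, lorZr).
have h1 : horosphere n1 q1.
  split; last by rewrite /q1 !lE nn1 (lorC n2 n1); lra.
  split; last by rewrite /q1 !mxE; apply: addr_gt0; apply: mulr_gt0 => //;
    rewrite invr_gt0.
  by rewrite /q1 !lE nn1 nn2 (lorC n2 n1); lra.
have h2 : horosphere n2 q2.
  split; last by rewrite /q2 !lE nn2; lra.
  split; last by rewrite /q2 !mxE; apply: addr_gt0; apply: mulr_gt0 => //;
    rewrite invr_gt0.
  by rewrite /q2 !lE nn1 nn2 (lorC n2 n1); lra.
have [_ A1 _ _] := spinorP 0 h1; have [B1 _ _ _] := spinorP 0 h2.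
have [[V1 [_ [_ /(_ q1 h1)[_ _ AE]]]] _ _ _] := decorationP S1.
have [_ [V2 [_ [_ /(_ q2 h2)[_ _ BE]]]] _ _] := decorationP S2.
move: A1 B1 AE BE; set A := Win S1 q1; set B := Wout S2 q2 => A1 B1.
rewrite !spin_projE => -[A0 A3 _ _] [B0 B3 _ _].
have half (v w : vec) : (2^-1 *: v + w) + (2^-1 *: v + w) = v + 2 *: w.
  by apply/vec4P; rewrite !mxE; field.
have Am : act A e0 - act A e3 = n1.
  by rewrite A0 A3 /Nin /Nout opprK addrC subrK.
have Ap : act A e0 + act A e3 = (2 * c) *: n2.
  by rewrite A0 A3 /Nin /Nout opprB addrA half -/n1 addrC addKr scalerA.
have Bp : act B e0 + act B e3 = n2 by rewrite B0 B3 /Nout addrC subrK.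
have Bm : act B e0 - act B e3 = (2 * c) *: n1.
  by rewrite B0 B3 /Nout opprB addrA half -/n2 addrC addKr scalerA.
have c2 : 0 < (2 * c)^-1 by rewrite invr_gt0 mulr_gt0.
have c2v (v : vec) : v = (2 * c)^-1 *: ((2 * c) *: v).
  by rewrite scalerA mulVf ?scale1r // -invr_eq0 gt_eqF.
have [l00 l33 l03] := lor_base.
have aA : adapted n1 n2 A.
  split => //; rewrite spin_projE /=; split; first exact: H3_act_e0.
  - by split; rewrite act_lor.
  - by exists 1; rewrite scale1r Am; split.
  - by exists (2 * c)^-1; rewrite Ap -c2v.
have aB : adapted n1 n2 B.
  split => //; rewrite spin_projE /=; split; first exact: H3_act_e0.
  - by split; rewrite act_lor.
  - by exists (2 * c)^-1; rewrite Bm -c2v.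
  - by exists 1; rewrite scale1r Bp; split.
have [e BAe] : exists e, B = A *m screw e.
  apply: (@adapted_diag A B (2 * c)^-1 (2 * c)) => //.
    by rewrite !actD Ap Bp -c2v.
  by rewrite !actD !act_oppr Am Bm.
have e2 : 2 * e / 2 = e by rewrite mulrAC divff ?mul1r // pnatr_eq0.
have gA := aA.2; have gB := aB.2.
rewrite !spin_projE /= A0 in gA; rewrite !spin_projE /= B0 in gB.
exists (expC e), q1, q2, (act A e3), (act B e3), (2 * e).
split; [exact: h1 | exact: gA | exact: h2 | exact: gB | split].
  by apply/(complex_distanceP _ aA aB); rewrite e2.
by rewrite e2.
Qed.

Lemma lambda_lengthE S1 S2 : ~ same_ideal (hvec S1) (hvec S2) ->
  lambda_length S1 S2 =
  Complex 0 1 * (spinor S2 0 * spinor S1 1 - spinor S2 1 * spinor S1 0).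
Proof.
move=> ns; rewrite /lambda_length; case: asboolP => // _.
by apply: lambda_spinor; apply: (xgetPex 0); exact: lambda_exists.
Qed.

End SpinorCalculus.

Theorem theorem4 (R : realType) (p : 'I_4 -> 'rV[R]_4)
    (S : 'I_4 -> spin_horosphere R) (lambda : 'I_4 -> 'I_4 -> R[i])
    (hp : ideal_tetrahedron p) (hS : forall i, centred_at (S i) (p i))
    (hlambda : forall i j, lambda i j = lambda_length (S i) (S j)) :
  lambda 0 2 * lambda 1 3 = lambda 0 1 * lambda 2 3 + lambda 1 2 * lambda 0 3.
Proof.
have [_ distinct] := hp.
have lE i j : i != j -> lambda i j =
    Complex 0 1 * (spinor (S j) 0 * spinor (S i) 1 -
                   spinor (S j) 1 * spinor (S i) 0).
  move=> ij; rewrite hlambda lambda_lengthE // => -[d [d0 dE]].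
  have [[a [a0 aE]] [b [b0 bE]]] := (hS i, hS j).
  apply: (distinct i j ij); exists (b^-1 * d * a); split.
    by rewrite !mulr_gt0 ?invr_gt0.
  by rewrite -!scalerA -aE -dE bE scalerA mulVf ?scale1r // gt_eqF.
by rewrite !lE //; ring.
Qed.
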